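(* Let $G$ be a topological group, let $N$ be a closed locally compact normal subgroup of $G$, and let $\widehat q:\rho G\to\rho(G/N)$ be the continuous homomorphic extension of the quotient homomorphism $q:G\to G/N$. Then $\widehat q$ is a quotient homomorphism with kernel $N$, $$\widehat q^{-1}(G/N)=G,$$ and $$r_\rho(G/N)=\widehat q\bigl(r_\rho(G)\bigr).$$ In particular, if $r_\rho(G)$ is pseudocompact, then $r_\rho(G/N)$ is pseudocompact.
   Context: All topological groups are assumed Hausdorff. For a topological group $G$, $\rho G$ denotes its Raikov completion, i.e. the completion with respect to the two-sided group uniformity; $G$ is regarded as a dense topological subgroup of $\rho G$. The Raikov remainder of $G$ is the subspace $r_\rho(G)=\rho G\setminus G$ of $\rho G$. Every continuous homomorphism $f:G\to K$ of topological groups extends uniquely to a continuous homomorphism $\widehat f:\rho G\to\rho K$. A quotient homomorphism is a continuous, open, surjective homomorphism of topological groups; $G/N$ carries the quotient topology. A Tychonoff space is pseudocompact if every continuous real-valued function on it is bounded; the empty space is regarded as pseudocompact. *)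

(* Defs.v *)
From HB Require Import structures.
From mathcomp Require Import all_boot all_order all_algebra.
From mathcomp Require Import all_classical all_reals all_analysis.
Import numFieldNormedType.Exports.

Set Implicit Arguments.
Unset Strict Implicit.
Unset Printing Implicit Defensive.

Local Open Scope classical_set_scope.
Local Open Scope quotient_scope.
Local Open Scope group_scope.

(** Topological groups. The Hausdorff axiom is not part of the structure: it is
    the separate predicate [hausdorff_space]. *)

HB.mixin Record isTopologicalGroup G & Topological G & Group G := {
  mulg_continuous : continuous (fun x : G * G => x.1 * x.2) ;
  invg_continuous : continuous (fun x : G => x^-1)
}.

#[short(type="topologicalGroupType")]
HB.structure Definition TopologicalGroup :=
  {G of Topological G & Group G & isTopologicalGroup G}.

Section TopologicalGroupTheory.
Context {G : topologicalGroupType}.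

Lemma mulg_cvg (x y : G) (U : set G) : nbhs (x * y) U ->
  exists2 VW : set G * set G, nbhs x VW.1 /\ nbhs y VW.2 &
    forall a b, VW.1 a -> VW.2 b -> U (a * b).
Proof.
move=> /(@mulg_continuous G (x, y)) [VW nVW sVW]; exists VW => // a b Va Wb.
exact: (sVW (a, b)).
Qed.

Lemma mulgl_nbhs (a x : G) (U : set G) :
  nbhs (a * x) U -> nbhs x [set y : G | U (a * y)].
Proof.
move=> /mulg_cvg[[V W] /= [nV nW] sU].
by apply: filterS nW => y Wy; apply: sU => //; exact: nbhs_singleton.
Qed.

Lemma mulgr_nbhs (a x : G) (U : set G) :
  nbhs (x * a) U -> nbhs x [set y : G | U (y * a)].
Proof.
move=> /mulg_cvg[[V W] /= [nV nW] sU].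
by apply: filterS nV => y Vy; apply: sU => //; exact: nbhs_singleton.
Qed.

Lemma invg_nbhs (x : G) (U : set G) :
  nbhs x^-1 U -> nbhs x [set y : G | U y^-1].
Proof. exact: invg_continuous. Qed.

End TopologicalGroupTheory.

(** The two-sided group uniformity. It lives on a copy of [G], since a
    topological group has several natural uniformities. *)

Definition two_sided (G : Type) : Type := G.

Section TwoSidedUniformity.
Context {G : topologicalGroupType}.

HB.instance Definition _ := Topological.copy (two_sided G) G.

Definition two_sided_base (U : set G) : set (two_sided G * two_sided G) :=
  [set p | U ((p.1 : G)^-1 * (p.2 : G)) /\ U ((p.1 : G) * (p.2 : G)^-1)].

Definition two_sided_entourage :
    set_system (two_sided G * two_sided G) :=
  filter_from (nbhs (1 : G)) two_sided_base.

Let ent_filter : Filter two_sided_entourage.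
Proof.
apply: filter_from_filter; first by exists setT; exact: filterT.
move=> U V nU nV; exists (U `&` V); first exact: filterI.
by move=> [x y] [[? ?] [? ?]]; split; split.
Qed.

Local Open Scope relation_scope.

Let ent_diag A : two_sided_entourage A -> diagonal `<=` A.
Proof.
move=> [U nU sU] [x y] xy; have {xy} <- : x = y by exact: xy.
by apply: sU; split => /=; rewrite ?mulVg ?mulgV; exact: nbhs_singleton.
Qed.

Let ent_inv A : two_sided_entourage A -> two_sided_entourage A^-1.
Proof.
move=> [U nU sU]; exists [set x : G | U (x^-1)%g]; last first.
  by move=> [x y] [/=]; rewrite !invgM !invgK => ? ?; apply: sU; split.
by apply: invg_nbhs; rewrite invg1.
Qed.

Let ent_split A : two_sided_entourage A ->
  exists2 B, two_sided_entourage B & B \; B `<=` A.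
Proof.
move=> [U nU sU].
have [|[V W] /= [nV nW] VWU] := @mulg_cvg G 1 1 U; first by rewrite mulg1.
exists (two_sided_base (V `&` W)).
  by exists (V `&` W) => //; exact: filterI.
move=> [x z] /= [y [/= [Vl Wl] [Vr Wr]] [/= [Vl' Wl'] [Vr' Wr']]].
apply: sU; split => /=.
- by have := VWU _ _ Vl Wl'; rewrite mulgA mulgK.
- by have := VWU _ _ Vr Wr'; rewrite mulgA mulgVK.
Qed.

Let ent_nbhs : nbhs = nbhs_ two_sided_entourage.
Proof.
apply/funext => x; apply/seteqP; split => A /=.
- move=> nA; exists (two_sided_base [set u | A ((x : G) * u)]).
    exists [set u : G | A ((x : G) * u)] => //.
    by apply: (@mulgl_nbhs G x 1 A); rewrite mulg1.
  by move=> y /xsectionP[/=]; rewrite mulgA mulgV mul1g.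
- move=> [E [U nU sU] sA].
  have nl : nbhs (x : G) [set y : G | U ((x : G)^-1 * y)%g].
    by apply: mulgl_nbhs; rewrite mulVg.
  have nr : nbhs (x : G) [set y : G | U ((x : G) * y^-1)%g].
    apply: (@invg_nbhs G x [set y : G | U ((x : G) * y)%g]).
    by apply: mulgl_nbhs; rewrite mulgV.
  apply: filterS (filterI nl nr) => y Uxy.
  by apply: sA; apply/xsectionP; exact: sU.
Qed.

HB.instance Definition _ := Nbhs_isUniform_mixin.Build (two_sided G)
  ent_filter ent_diag ent_inv ent_split ent_nbhs.

End TwoSidedUniformity.

Definition raikov_complete (G : topologicalGroupType) :=
  forall F : set_system (two_sided G),
    ProperFilter F -> cauchy F -> exists x : two_sided G, F --> x.

Section Homomorphisms.
Context {G H : topologicalGroupType}.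
Implicit Types f : G -> H.

Definition continuous_hom f := {morph f : x y / x * y} /\ continuous f.

Definition quotient_hom f :=
  [/\ continuous_hom f,
      forall U : set G, open U -> open (f @` U) &
      forall y, exists x, f x = y].

Definition hom_kernel f : set G := [set x | f x = 1].

(** Isomorphism of topological groups onto the image: besides injectivity, [G]
    has the initial topology, so in particular [f] is continuous. *)
Definition group_embedding f :=
  [/\ {morph f : x y / x * y}, injective f &
      forall U : set G, open U <-> exists2 V : set H, open V & U = f @^-1` V].

(** [H], together with [f : G -> H], is the Raikov completion of [G]: a
    Hausdorff group, complete for its two-sided uniformity, that contains a
    copy [range f] of [G] as a dense topological subgroup. *)
Definition raikov_completion f :=
  [/\ hausdorff_space H, raikov_complete H, group_embedding f &
      dense (range f)].

Definition raikov_remainder f : set H := ~` range f.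

End Homomorphisms.

(** [fhat] is the continuous homomorphic extension of [f] to the completions
    [iG : G -> rG] and [iK : K -> rK]. *)
Definition completion_extension (G K rG rK : topologicalGroupType)
    (iG : G -> rG) (iK : K -> rK) (f : G -> K) (fhat : rG -> rK) :=
  continuous_hom fhat /\ (forall x, fhat (iG x) = iK (f x)).

(** Complete regularity is not required here. The definition is only applied to
    subspaces of Hausdorff topological groups, which are Tychonoff. *)
Definition pseudocompact (R : realType) (T : topologicalType) :=
  forall f : T -> R, continuous f -> bounded_set (range f).

(** The quotient [G / N], with the group structure of cosets and the quotient
    topology. *)

Record normalSubgroup (G : groupType) := NormalSubgroup {
  normal_set :> set G ;
  normal1 : normal_set 1 ;
  normalM : forall x y, normal_set x -> normal_set y -> normal_set (x * y) ;
  normalV : forall x, normal_set x -> normal_set x^-1 ;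
  normalJ : forall x y, normal_set x -> normal_set (x ^ y)
}.

Section QuotientGroup.
Context {G : topologicalGroupType} (N : normalSubgroup G).
Implicit Types x y : G.

Definition coset_rel : rel G := fun x y => `[< normal_set N (x^-1 * y) >].

Let coset_refl : reflexive coset_rel.
Proof. by move=> x; apply/asboolP; rewrite mulVg; exact: normal1. Qed.

Let coset_imp x y : coset_rel x y -> coset_rel y x.
Proof.
by move=> /asboolP/normalV; rewrite invgM invgK => ?; exact/asboolP.
Qed.

Let coset_sym : symmetric coset_rel.
Proof. by move=> x y; apply/idP/idP; exact: coset_imp. Qed.

Let coset_trans : transitive coset_rel.
Proof.
move=> y x z /asboolP xy /asboolP yz; apply/asboolP.
by have := normalM xy yz; rewrite mulgA mulgK.
Qed.

Canonical coset_equiv := EquivRel coset_rel coset_refl coset_sym coset_trans.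

Definition quotient_group := quotient_topology {eq_quot coset_equiv}.

HB.instance Definition _ := Topological.on quotient_group.
HB.instance Definition _ := Quotient.on quotient_group.

Definition quotient_map (x : G) : quotient_group := \pi_quotient_group x.

Lemma quotient_mapP x y : quotient_map x = quotient_map y <-> normal_set N (x^-1 * y).
Proof. by split=> [/eqmodP/asboolP//|?]; apply/eqmodP/asboolP. Qed.

Lemma quotient_mapK (a : quotient_group) : quotient_map (repr a) = a.
Proof. exact: reprK. Qed.

Definition quotient_mul (a b : quotient_group) : quotient_group :=
  quotient_map (repr a * repr b).

Definition quotient_inv (a : quotient_group) : quotient_group :=
  quotient_map (repr a)^-1.

Lemma quotient_mulE x y :
  quotient_mul (quotient_map x) (quotient_map y) = quotient_map (x * y).
Proof.
have /quotient_mapP Nx := quotient_mapK (quotient_map x).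
have /quotient_mapP Ny := quotient_mapK (quotient_map y).
apply/quotient_mapP; move: (repr _) (repr _) Nx Ny => a b Nx Ny.
have := normalM Ny (normalJ y Nx).
by rewrite conjgE invgM -!mulgA mulVKg.
Qed.

Lemma quotient_invE x :
  quotient_inv (quotient_map x) = quotient_map x^-1.
Proof.
have /quotient_mapP Nx := quotient_mapK (quotient_map x).
apply/quotient_mapP; move: (repr _) Nx => a Nx.
have := normalJ x^-1 (normalV Nx).
by rewrite conjgE invgM !invgK -!mulgA mulVKg.
Qed.

Let qmulA : associative quotient_mul.
Proof.
move=> a b c; rewrite -(quotient_mapK a) -(quotient_mapK b) -(quotient_mapK c).
by rewrite !quotient_mulE mulgA.
Qed.

Let qmul1g : left_id (quotient_map 1) quotient_mul.
Proof. by move=> a; rewrite -(quotient_mapK a) quotient_mulE mul1g. Qed.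

Let qmulg1 : right_id (quotient_map 1) quotient_mul.
Proof. by move=> a; rewrite -(quotient_mapK a) quotient_mulE mulg1. Qed.

Let qmulVg : left_inverse (quotient_map 1) quotient_inv quotient_mul.
Proof.
by move=> a; rewrite -(quotient_mapK a) quotient_invE quotient_mulE mulVg.
Qed.

Let qmulgV : right_inverse (quotient_map 1) quotient_inv quotient_mul.
Proof.
by move=> a; rewrite -(quotient_mapK a) quotient_invE quotient_mulE mulgV.
Qed.

HB.instance Definition _ := isGroup.Build quotient_group
  qmulA qmul1g qmulg1 qmulVg qmulgV.

Lemma quotient_mapM : {morph quotient_map : x y / x * y}.
Proof. by move=> x y; rewrite -quotient_mulE. Qed.

Lemma quotient_map_continuous : continuous quotient_map.
Proof. exact: pi_continuous. Qed.

Lemma quotient_map_open (U : set G) : open U -> open (quotient_map @` U).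
Proof.
move=> oU.
suff : open (quotient_map @^-1` (quotient_map @` U)) by [].
rewrite openE => x [u Uu /quotient_mapP Nux].
have : nbhs x [set y | U (y * (u^-1 * x)^-1)].
  apply: mulgr_nbhs; rewrite invgM invgK mulgA mulgV mul1g.
  exact: open_nbhs_nbhs.
apply: filterS => y /= Uy; exists (y * (u^-1 * x)^-1) => //.
by apply/quotient_mapP; rewrite !invgM !invgK mulgVK.
Qed.

Lemma quotient_map_nbhs x (A : set G) :
  nbhs x A -> nbhs (quotient_map x) (quotient_map @` A).
Proof.
rewrite nbhsE => -[U [oU Ux] sUA]; rewrite nbhsE.
exists (quotient_map @` U); last exact: image_subset.
by split; [exact: quotient_map_open|exists x].
Qed.

Let qmul_continuous :
  continuous (fun a : quotient_group * quotient_group => a.1 * a.2).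
Proof.
move=> [a b] U; rewrite -(quotient_mapK a) -(quotient_mapK b) /= -quotient_mapM.
move=> /quotient_map_continuous /mulg_cvg[[V W] /= [nV nW] sU].
exists (quotient_map @` V, quotient_map @` W) => /=.
  by split; exact: quotient_map_nbhs.
move=> [_ _] /= [[v Vv <-] [w Ww <-]].
by rewrite -quotient_mapM; exact: sU.
Qed.

Lemma quotient_mapV x : quotient_map x^-1 = (quotient_map x)^-1.
Proof. by rewrite -quotient_invE. Qed.

Let qinv_continuous : continuous (fun a : quotient_group => a^-1).
Proof.
move=> a U; rewrite -(quotient_mapK a) -quotient_mapV.
move=> /quotient_map_continuous /invg_nbhs /quotient_map_nbhs.
apply: filterS => _ [x Ux <-] /=; rewrite -quotient_mapV; exact: Ux.
Qed.

HB.instance Definition _ := isTopologicalGroup.Build quotient_group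
  qmul_continuous qinv_continuous.

End QuotientGroup.

Lemma quotient_map_quotient_hom (G : topologicalGroupType)
  (N : normalSubgroup G) : quotient_hom (quotient_map N).
Proof.
split; last by move=> y; exists (repr y); exact: quotient_mapK.
- by split; [exact: quotient_mapM|exact: quotient_map_continuous].
- exact: quotient_map_open.
Qed.

Lemma quotient_map_kernel (G : topologicalGroupType) (N : normalSubgroup G) :
  hom_kernel (quotient_map N) = N.
Proof.
apply/seteqP; split=> x.
- move=> x1; have : quotient_map N 1 = quotient_map N x by rewrite x1.
  by move/quotient_mapP; rewrite invg1 mul1g.
- by move=> Nx; apply/esym; apply/quotient_mapP; rewrite invg1 mul1g.
Qed.

(* Main.v *)
Require Import Defs.
From mathcomp Require Import all_boot all_order all_algebra.
From mathcomp Require Import all_classical all_reals all_analysis.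
Import numFieldNormedType.Exports.

Set Implicit Arguments.
Unset Strict Implicit.
Unset Printing Implicit Defensive.

Local Open Scope classical_set_scope.

(** The heart of the matter is that the continuous extension [qhat] of the
    quotient map [q] has no larger kernel than [q], and remains open.

    Since [q] is open and [iQ] is an embedding, [qhat] restricted to the dense
    subgroup [D = range iG] is open onto its image: a point of [D] whose image
    is near [1] has the same image as a point of [D] near [1]. Hence a point
    [x] of the kernel of [qhat] is a limit of points [y] of [D] that can be
    corrected by factors [u] near [1] into elements [y * u^-1] of
    [D `&` hom_kernel qhat], which is [iG @` N]. So the kernel is the closure
    of [iG @` N] ([kernel_closure]); as [iG @` N] is a locally compact
    subgroup of a Hausdorff group, it is already closed
    ([locally_compact_subgroup_closed]).

    For openness at [1] ([image_nbhs1]), let [z] be near [1] in [rQ]. The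
    points [t] of [D] that are near [1] and whose image is near [z] generate a
    proper filter; extend it to an ultrafilter. If [a] and [t] are two such
    points, [qhat (a^-1 * t)] is near [1], so [a^-1 * t = k * u] with [u]
    arbitrarily near [1] and [k] in the part of [iG @` N] near [1], which is
    compact. An ultrafilter that lies in a set [a * K * V] with [K] compact
    lies in some [a * k * V'] ([ultra_compact_select]), so ours is small for
    the left uniformity, and symmetrically for the right one: it is a Cauchy
    filter ([small_cauchy]). Its limit in the complete group [rG] is near [1]
    and is mapped to [z].

    Being open, [qhat] has an open subgroup of [rQ] as its image, and this
    image contains the dense subgroup [range iQ], so [qhat] is surjective
    ([quotient_hom_of_nbhs1]). The remaining claims are formal: the kernel is
    contained in [range iG], hence [range iG] is the full preimage of
    [range iQ], and the remainder of [rQ] is the continuous image of the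
    remainder of [rG]. *)

(** * Homomorphisms and neighbourhoods of the identity *)

Section Morphisms.
Local Open Scope group_scope.
Variables (G H : groupType) (f : G -> H).
Hypothesis fM : {morph f : x y / x * y}.

Lemma hom1 : f 1 = 1.
Proof. by apply: (mulgI (f 1)); rewrite -fM !mulg1. Qed.

Lemma homV x : f x^-1 = (f x)^-1.
Proof. by apply: (mulgI (f x)); rewrite -fM !mulgV hom1. Qed.

End Morphisms.

Section TopologicalGroups.
Local Open Scope group_scope.
Variable P : topologicalGroupType.
Implicit Types (U V M C : set P) (x y : P).

(** Three factors are what the proofs below consume: the product of two close
    points and a correction; fewer factors are obtained by taking some of them
    equal to [1]. *)
Lemma symmetric_nbhs3 U : nbhs (1 : P) U ->
  exists V, [/\ nbhs (1 : P) V, forall x, V x -> V x^-1 &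
    forall x y z, V x -> V y -> V z -> U (x * y * z)].
Proof.
rewrite -{1}(mulg1 1) => /mulg_cvg[[A C] /= [nA nC] AC].
move: nA; rewrite -{1}(mulg1 1) => /mulg_cvg[[A1 A2] /= [nA1 nA2] A12].
pose B := A1 `&` A2 `&` C.
have nB : nbhs (1 : P) B by do 2 ?apply: filterI.
exists (B `&` [set x | B x^-1]); split.
- by apply: filterI => //; apply: invg_nbhs; rewrite invg1.
- by move=> x [Bx BVx]; split => //=; rewrite invgK.
- move=> x y z [[[? _] _] _] [[[_ ?] _] _] [[_ ?] _].
  by apply: AC => //; exact: A12.
Qed.

Lemma nbhs_translate U x : nbhs (1 : P) U -> nbhs x [set y | U (x^-1 * y)].
Proof. by move=> nU; apply: mulgl_nbhs; rewrite mulVg. Qed.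

(** Local compactness of the subgroup [M] enters through [C], a neighbourhood
    of [1] in [M] that is closed in [P]: in a Hausdorff group, a compact one
    will do. A point [x] of the closure of [M] is translated by some
    [m] in [M] into [U]; there [m^-1 * x] is adherent to [C], which is
    closed. *)
Lemma locally_compact_subgroup_closed M C U :
  (forall x y, M x -> M y -> M (x * y)) -> (forall x, M x -> M x^-1) ->
  nbhs (1 : P) U -> closed C -> M `&` U `<=` C -> C `<=` M -> closed M.
Proof.
move=> MM MV nU cC MUC CM x clMx.
have [V [nV VV VVV]] := symmetric_nbhs3 nU.
have [m [Mm Vm]] := clMx _ (nbhs_translate x nV).
rewrite -(mulVKg m x); apply: (MM _ _ Mm); apply: CM.
apply: cC => B /(@mulgl_nbhs P m^-1 x) nB.
have [y [My [By Vy]]] := clMx _ (filterI nB (nbhs_translate x nV)).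
exists (m^-1 * y); split => //; apply: MUC; split.
  exact: (MM _ _ (MV _ Mm) My).
have := VVV _ _ _ (nbhs_singleton nV) (VV _ Vm) Vy.
by rewrite mul1g invgM invgK mulgA mulgK.
Qed.

End TopologicalGroups.

(** * Ultrafilters and compact sets *)

(** An infinite form of the pigeonhole principle: if every point of [K] had a
    neighbourhood whose points [F]-almost never witness [Q], finitely many of
    these would cover [K], and [F]-almost no [t] would have a witness. *)
Lemma ultra_compact_select (T : Type) (X : topologicalType)
    (F : set_system T) (K : set X) (Q : T -> X -> Prop) :
  UltraFilter F -> compact K ->
  (\forall t \near F, exists2 x, K x & Q t x) ->
  exists2 x, K x & forall V, nbhs x V ->
    \forall t \near F, exists2 y, V y & Q t y.
Proof.
move=> UF /compact_near_coveringP cK FQ; apply: contrapT => noK.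
suff FnQ : \forall t \near F, K `<=` (fun x => ~ Q t x).
  by have [t [[x Kx Qtx] /(_ x Kx)]] := filter_ex (filterI FQ FnQ).
apply: cK => x Kx.
have [V nV FV] :
    exists2 V, nbhs x V & ~ \forall t \near F, exists2 y, V y & Q t y.
  apply: contrapT => noV; apply: noK; exists x => // V nV.
  by apply: contrapT => FV; apply: noV; exists V.
have [//|FnV] := in_ultra_setVsetC [set t | exists2 y, V y & Q t y] UF.
exists (V, ~` [set t | exists2 y, V y & Q t y]) => //= -[y t] /= [Vy nQ] Qty.
by apply: nQ; exists y.
Qed.

Section UltrafiltersOnGroups.
Local Open Scope group_scope.
Variables (P : topologicalGroupType) (F : set_system P) (C : set P).
Hypotheses (UF : UltraFilter F) (cC : compact C).

(** If [F] contains, for every [U], some left translate of [C * U], then it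
    contains, for every [U], some left translate of [U]. This and its mirror
    image reduce the two halves of the Cauchy property to the compactness of
    [C]. *)
Lemma ultra_left_small :
  (forall U, nbhs (1 : P) U -> exists a, \forall t \near F,
    exists2 k, C k & U (k^-1 * (a^-1 * t))) ->
  forall U, nbhs (1 : P) U -> exists a, \forall t \near F, U (a^-1 * t).
Proof.
move=> FC U /symmetric_nbhs3[V [nV VV VVV]].
have [a Fa] := FC V nV.
have [k Ck Fk] := ultra_compact_select UF cC Fa.
exists (a * k); apply: filterS (Fk _ (nbhs_translate k nV)) => t [y /= Vy Vt].
have := VVV _ _ _ (nbhs_singleton nV) Vy Vt.
by rewrite mul1g invgM !mulgA mulgK.
Qed.

Lemma ultra_right_small :
  (forall U, nbhs (1 : P) U -> exists a, \forall t \near F,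
    exists2 k, C k & U ((t * a^-1) * k^-1)) ->
  forall U, nbhs (1 : P) U -> exists a, \forall t \near F, U (t * a^-1).
Proof.
move=> FC U /symmetric_nbhs3[V [nV VV VVV]].
have [a Fa] := FC V nV.
have [k Ck Fk] := ultra_compact_select UF cC Fa.
have nVk : nbhs k [set y | V (y * k^-1)] by apply: mulgr_nbhs; rewrite mulgV.
exists (k * a); apply: filterS (Fk _ nVk) => t [y /= Vy Vt].
have := VVV _ _ _ (nbhs_singleton nV) Vt Vy.
by rewrite mul1g invgM !mulgA mulgVK.
Qed.

End UltrafiltersOnGroups.

(** The centres [a] and [b] may differ: the two-sided uniformity is the join of
    the left and the right one, so the two halves can be checked separately. *)
Lemma small_cauchy (P : topologicalGroupType) (F : set_system P) :
  Filter F ->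
  (forall U, nbhs (1 : P)%g U -> exists a, \forall t \near F, U (a^-1 * t)%g) ->
  (forall U, nbhs (1 : P)%g U -> exists a, \forall t \near F, U (t * a^-1)%g) ->
  cauchy (F : set_system (two_sided P)).
Proof.
move=> FF Fl Fr A [U nU sUA].
have [V [nV VV VVV]] := symmetric_nbhs3 nU.
have [a Fa] := Fl V nV; have [b Fb] := Fr V nV.
pose S := [set t | V (a^-1 * t)%g] `&` [set t | V (t * b^-1)%g].
have FS : F S by exact: filterI.
exists (S, S) => //= -[x y] /= [[Vax Vxb] [Vay Vyb]]; apply: sUA; split => /=.
- have := VVV _ _ _ (nbhs_singleton nV) (VV _ Vax) Vay.
  by rewrite mul1g invgM invgK -mulgA mulVKg.
- have := VVV _ _ _ (nbhs_singleton nV) Vxb (VV _ Vyb).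
  by rewrite mul1g invgM invgK mulgA mulgVK.
Qed.

(** * Homomorphisms that are open on a dense subgroup *)

Section ExtensionFromDense.
Local Open Scope group_scope.
Variables (P T : topologicalGroupType) (f : P -> T) (D : set P).
(** [D_open] says that [f] restricted to the subgroup [D] is open onto its
    image. This alone does not make [f] open: the points of [T] near [1] that
    lie outside [f @` D] can only be reached by limits taken in [P]. *)
Hypotheses (f_hom : continuous_hom f)
  (DM : forall x y, D x -> D y -> D (x * y)) (DV : forall x, D x -> D x^-1)
  (D_open : forall U, nbhs (1 : P) U -> exists2 V, nbhs (1 : T) V &
     forall d, D d -> V (f d) -> exists e, [/\ D e, U e & f e = f d]).

(** A point [y] of [D] close to a point of the kernel has its image close to
    [1], so some [u] in [D] close to [1] has the same image; then [y * u^-1] is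
    in the kernel and still close. *)
Lemma kernel_closure :
  dense D -> hom_kernel f `<=` closure (hom_kernel f `&` D).
Proof.
case: f_hom => fM fc dD x fx1 B.
rewrite -{1}(mulg1 x) => /mulg_cvg[[A U] /= [nA nU] AUB].
have nU' : nbhs (1 : P) [set u | U u^-1] by apply: invg_nbhs; rewrite invg1.
have [V nV DVf] := D_open nU'.
have nfV : nbhs x (f @^-1` V) by apply: fc; rewrite fx1.
have : nbhs x (A `&` f @^-1` V) by exact: filterI.
rewrite nbhsE => -[E [oE Ex] sE].
have [y [Ey Dy]] := dD _ (ex_intro _ _ Ex) oE.
have [Ay Vy] := sE _ Ey.
have [u [Du Uu fu]] := DVf _ Dy Vy.
exists (y * u^-1); split; last exact: AUB.
split; last by apply: DM => //; exact: DV.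
by rewrite /hom_kernel /= fM (homV fM) fu mulgV.
Qed.

(** Here local compactness of the kernel meets completeness. Completeness of
    [P] alone would not give the result, since quotients of complete groups
    need not be complete: a Cauchy filter on [f @` D] lifts to a filter on [D]
    that is Cauchy only up to the kernel. As the lift stays near [1], only the
    part of the kernel in [C] matters, and an ultrafilter makes a choice in
    the compact set [C]. *)
Lemma image_nbhs1 (W C : set P) : raikov_complete P -> hausdorff_space T ->
  dense (f @` D) -> nbhs (1 : P) W -> compact C ->
  hom_kernel f `&` D `&` W `<=` C ->
  forall U, nbhs (1 : P) U -> nbhs (1 : T) (f @` U).
Proof.
case: f_hom => fM fc cP hT dfD nW cC WC U nU.
have [Y [nY YV YYY]] := symmetric_nbhs3 (filterI nU nW).
have [Y' nY' DY'] := D_open nY.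
move: nY'; rewrite nbhsE => -[E [oE E1] EY'].
exists E => // z Ez.
(* Lifting the trace on [f @` D] of the neighbourhoods of [z] inside [Y] keeps
   the limit in [U] and the indeterminacy in [W]. *)
pose F0 := filter_from (nbhs z) (fun B => D `&` Y `&` f @^-1` B).
have F0P : ProperFilter F0.
  apply: filter_from_proper; first apply: filter_from_filter.
  - by exists setT; exact: filterT.
  - move=> A B nA nB; exists (A `&` B); first exact: filterI.
    by move=> x [? [? ?]].
  move=> B; rewrite nbhsE => -[B1 [oB1 B1z] sB].
  have [y [[By Ey] [d Dd dy]]] : (B1 `&` E) `&` (f @` D) !=set0.
    apply: dfD; first by exists z.
    exact: openI.
  have [|e [De Ye fe]] := DY' _ Dd; first by rewrite dy; exact: EY'.
  by exists e; split => //=; rewrite fe dy; exact: sB.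
have [F [UF F0F]] := ultraFilterLemma F0P.
have FF : Filter F by apply: ultra_proper.
have FB B : nbhs z B -> F (D `&` Y `&` f @^-1` B).
  by move=> nB; apply: F0F; exists B.
(* Two points [a], [t] of a small set of [F] have close images, so [a^-1 * t]
   is [k * u] with [u] small in [D]; hence [k] is in the kernel, and in [W] as
   a product of three elements of [Y]. *)
have Fl V : nbhs (1 : P) V -> exists a, \forall t \near F,
    exists2 k, C k & V (k^-1 * (a^-1 * t)).
  move=> nV; have [V' nV' DV'] := D_open (filterI nV nY).
  move: nV'; rewrite -{1}(mulVg z) => /mulg_cvg[[B1 B2] /= [nB1 nB2] B12].
  have FS : F (D `&` Y `&` f @^-1` ([set y | B1 y^-1] `&` B2)).
    by apply: FB; apply: filterI nB2; exact: invg_nbhs.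
  have [a [[Da Ya] [/= B1a _]]] := filter_ex FS.
  exists a; apply: filterS FS => t [[Dt Yt] [_ /= B2t]].
  have [] := DV' (a^-1 * t); first by apply: DM => //; exact: DV.
    by rewrite fM (homV fM); exact: B12.
  move=> u [Du [Vu Yu] fu]; exists (a^-1 * t * u^-1); last first.
    by rewrite invgM invgK mulgVK.
  apply: WC; split; first split.
  - by rewrite /hom_kernel /= fM (homV fM) fu mulgV.
  - exact: (DM (DM (DV Da) Dt) (DV Du)).
  - exact: (YYY _ _ _ (YV _ Ya) Yt (YV _ Yu)).2.
(* The mirror image: [t * a^-1] is [u * k]. *)
have Fr V : nbhs (1 : P) V -> exists a, \forall t \near F,
    exists2 k, C k & V (t * a^-1 * k^-1).
  move=> nV; have [V' nV' DV'] := D_open (filterI nV nY).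
  move: nV'; rewrite -{1}(mulgV z) => /mulg_cvg[[B1 B2] /= [nB1 nB2] B12].
  have FS : F (D `&` Y `&` f @^-1` (B1 `&` [set y | B2 y^-1])).
    by apply: FB; apply: filterI nB1 _; exact: invg_nbhs.
  have [a [[Da Ya] [_ /= B2a]]] := filter_ex FS.
  exists a; apply: filterS FS => t [[Dt Yt] [/= B1t _]].
  have [] := DV' (t * a^-1); first by apply: DM => //; exact: DV.
    by rewrite fM (homV fM); exact: B12.
  move=> u [Du [Vu Yu] fu]; exists (u^-1 * (t * a^-1)); last first.
    by rewrite invgM invgK mulVKg.
  apply: WC; split; first split.
  - by rewrite /hom_kernel /= fM (homV fM) fu mulVg.
  - exact: (DM (DV Du) (DM Dt (DV Da))).
  - by rewrite mulgA; apply: (YYY _ _ _ (YV _ Yu) Yt (YV _ Ya)).2.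
have [x Fx] := cP F _ (small_cauchy FF (ultra_left_small UF cC Fl)
  (ultra_right_small UF cC Fr)).
exists x.
- have [t [[[_ Yt] _] /= Yxt]] :=
    filter_ex (filterI (FB _ filterT) (Fx _ (nbhs_translate x nY))).
  have := (YYY _ _ _ (nbhs_singleton nY) Yt (YV _ Yxt)).1.
  by rewrite mul1g invgM invgK mulVKg.
- apply: hT => A B nA nB.
  have [t [[_ Bt] At]] := filter_ex (filterI (FB _ nB) (Fx _ (fc _ _ nA))).
  by exists (f t).
Qed.

(** Surjectivity comes for free: the image is a neighbourhood of [1], so each
    translate [z * range f] meets the dense set [f @` D]. *)
Lemma quotient_hom_of_nbhs1 : dense (f @` D) ->
  (forall U, nbhs (1 : P) U -> nbhs (1 : T) (f @` U)) -> quotient_hom f.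
Proof.
case: (f_hom) => fM fc dfD fo; split => //.
- move=> U oU; rewrite openE => _ [x Ux <-].
  have nU : nbhs (1 : P) [set y | U (x * y)].
    by apply: mulgl_nbhs; rewrite mulg1; exact: open_nbhs_nbhs.
  apply: filterS (nbhs_translate (f x) (fo _ nU)) => t [y Uy fy].
  by exists (x * y) => //; rewrite fM fy mulVKg.
- move=> z.
  have nz : nbhs z [set t | range f (z^-1 * t)].
    by apply: nbhs_translate; exact: fo filterT.
  move: nz; rewrite nbhsE => -[E [oE Ez] sE].
  have [y [Ey [d Dd dy]]] := dfD _ (ex_intro _ _ Ez) oE.
  have [x _ fx] := sE _ Ey.
  by exists (d * x^-1); rewrite fM (homV fM) fx dy invgM invgK mulVKg.
Qed.

End ExtensionFromDense.

(** * Subspaces, embeddings and pseudocompactness *)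

Lemma locally_compact_trace (X : topologicalType) (N : set X) (x : X) :
  locally_compact [set: set_type N] -> N x ->
  exists A W : set X, [/\ compact A, A `<=` N, nbhs x W & N `&` W `<=` A].
Proof.
move=> lN Nx; have x_in : x \in N by exact/mem_set.
have := lN (exist (fun y => y \in N) x x_in) I.
case=> B + [cB _]; rewrite withinET => -[_ [[W oW <-] Wx WB]].
have vc : continuous (set_val : set_type N -> X) by exact: initial_continuous.
exists (set_val @` B), W; split.
- by apply: continuous_compact => //; exact: continuous_subspaceT.
- by move=> _ [[y Ny] _ <-]; exact: set_mem.
- by apply: open_nbhs_nbhs; split => //; exact: Wx.
- move=> y [/mem_set Ny Wy]; exists (exist (fun y => y \in N) y Ny) => //.
  exact: (WB _ _).
Qed.

Section Embeddings.
Variables (G H : topologicalGroupType) (i : G -> H).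
Hypothesis i_emb : group_embedding i.

Lemma embedding_continuous : continuous i.
Proof.
by case: i_emb => _ _ iE; apply/continuousP => V oV; apply/iE; exists V.
Qed.

Lemma embedding_nbhs1 (U : set G) : nbhs (1 : G)%g U ->
  exists2 V, nbhs (1 : H)%g V & i @^-1` V `<=` U.
Proof.
case: i_emb => iM _ iE; rewrite nbhsE => -[E [oE E1] EU].
have [V oV EV] := (iE E).1 oE; exists V; last by rewrite -EV.
apply: open_nbhs_nbhs; split => //.
by rewrite -(hom1 iM); move: E1; rewrite EV.
Qed.

End Embeddings.

Lemma pseudocompact_image (R : realType) (X Y : topologicalType)
    (g : X -> Y) : continuous g -> (forall y, exists x, g x = y) ->
  pseudocompact R X -> pseudocompact R Y.
Proof.
move=> gc gs pX h hc.
have /pX : continuous (h \o g).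
  by move=> x; apply: continuous_comp; [exact: gc|exact: hc].
congr (bounded_set _); apply/seteqP; split => [_ [x _ <-]|_ [y _ <-]].
- by exists (g x).
- by have [x <-] := gs y; exists x.
Qed.

(** * The extended quotient homomorphism *)

Theorem corollary3p16 (R : realType) (G : topologicalGroupType)
    (N : normalSubgroup G) (rG rQ : topologicalGroupType)
    (iG : G -> rG) (iQ : quotient_group N -> rQ) (qhat : rG -> rQ) :
  hausdorff_space G ->
  closed N ->
  locally_compact [set: set_type N] ->
  raikov_completion iG ->
  raikov_completion iQ ->
  completion_extension iG iQ (quotient_map N) qhat ->
  [/\ quotient_hom qhat,
      hom_kernel qhat = iG @` N,
      qhat @^-1` range iQ = range iG,
      raikov_remainder iQ = qhat @` raikov_remainder iG &
      pseudocompact R (set_type (raikov_remainder iG)) ->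
      pseudocompact R (set_type (raikov_remainder iQ))].
Proof.
move=> _ _ lN [hG cG eG dG] [hQ _ eQ dQ] [qhom qi].
have [qM qc] := qhom; have [iM iI _] := eG; have [jM jI _] := eQ.
have j1 := hom1 jM.
have RM x y : range iG x -> range iG y -> range iG (x * y)%g.
  by move=> [a _ <-] [b _ <-]; exists (a * b)%g.
have RV x : range iG x -> range iG x^-1%g.
  by move=> [a _ <-]; exists a^-1%g; rewrite // (homV iM).
have R_open U : nbhs (1 : rG)%g U -> exists2 V, nbhs (1 : rQ)%g V &
    forall d, range iG d -> V (qhat d) ->
      exists e, [/\ range iG e, U e & qhat e = qhat d].
  move=> nU.
  have nqU : nbhs (1 : quotient_group N)%g (quotient_map N @` (iG @^-1` U)).
    rewrite -(hom1 (@quotient_mapM _ N)); apply: quotient_map_nbhs.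
    by apply: (embedding_continuous eG); rewrite (hom1 iM).
  have [V nV VU] := embedding_nbhs1 eQ nqU; exists V => // _ [g _ <-].
  rewrite qi => /VU[h Uh qhg]; exists (iG h); split => //.
  by rewrite qi qhg.
have kerR : hom_kernel qhat `&` range iG = iG @` N.
  apply/seteqP; split=> [y [ky [x _ xy]]|_ [x Nx <-]].
  - exists x => //; rewrite -quotient_map_kernel; apply: jI.
    by rewrite j1 -qi xy.
  - split; last by exists x.
    rewrite /hom_kernel /= qi -j1; congr iQ.
    by move: Nx; rewrite -{1}quotient_map_kernel.
have [A [W0 [cA AN nW0 NWA]]] := locally_compact_trace lN (normal1 N).
have [W nW WW0] := embedding_nbhs1 eG nW0.
have cC : compact (iG @` A).
  apply: continuous_compact => //.
  by apply: continuous_subspaceT; exact: embedding_continuous.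
have NWC : iG @` N `&` W `<=` iG @` A.
  move=> _ [[x Nx <-] Wx]; exists x => //; apply: NWA; split => //.
  exact: WW0.
have cN : closed (iG @` N).
  apply: (locally_compact_subgroup_closed _ _ nW (compact_closed hG cC) NWC).
  - move=> _ _ [x Nx <-] [y Ny <-].
    by exists (x * y)%g; [exact: normalM|exact: iM].
  - by move=> _ [x Nx <-]; exists x^-1%g; [exact: normalV|exact: (homV iM)].
  - exact: image_subset.
have ker : hom_kernel qhat = iG @` N.
  apply/seteqP; split; last by rewrite -kerR; exact: subIsetl.
  by move=> x /(kernel_closure qhom RM RV R_open dG); rewrite kerR; exact: cN.
have dqG : dense (qhat @` range iG).
  rewrite (_ : qhat @` range iG = range iQ) //.
  apply/seteqP; split=> [_ [_ [x _ <-] <-]|_ [a _ <-]].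
  - by rewrite qi; exists (quotient_map N x).
  - exists (iG (repr a)); first by exists (repr a).
    by rewrite qi quotient_mapK.
have qq : quotient_hom qhat.
  apply: (quotient_hom_of_nbhs1 qhom dqG).
  apply: (image_nbhs1 qhom RM RV R_open cG hQ dqG nW cC).
  by rewrite kerR.
have pre : qhat @^-1` range iQ = range iG.
  apply/seteqP; split=> [x [a _ ax]|_ [x _ <-]]; last first.
    by rewrite /= qi; exists (quotient_map N x).
  have : hom_kernel qhat (x * (iG (repr a))^-1)%g.
    by rewrite /hom_kernel /= qM (homV qM) qi quotient_mapK ax mulgV.
  rewrite ker => -[n _ nx].
  by exists (n * repr a)%g => //; rewrite iM nx mulgVK.
have [_ _ qs] := qq.
have rem : raikov_remainder iQ = qhat @` raikov_remainder iG.
  rewrite /raikov_remainder -pre; apply/seteqP; split=> [y yQ|_ [x xQ <-] //].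
  by have [x xy] := qs y; exists x => //; rewrite /= xy.
split => //.
have qrem (x : set_type (raikov_remainder iG)) :
    qhat (set_val x) \in raikov_remainder iQ.
  by apply/mem_set; rewrite rem; exists (set_val x) => //; exact: set_valP.
pose g x : set_type (raikov_remainder iQ) :=
  exist (fun y => y \in raikov_remainder iQ) (qhat (set_val x)) (qrem x).
apply: (@pseudocompact_image _ _ _ g).
- apply: (@continuous_comp_initial _ _ _ set_val).
  have vc : continuous (set_val : set_type (raikov_remainder iG) -> rG).
    exact: initial_continuous.
  by move=> x; apply: (continuous_comp (vc x)); exact: qc.
- move=> [y yQ]; have := set_mem yQ; rewrite {1}rem => -[x xG xy].
  exists (exist (fun x => x \in raikov_remainder iG) x (mem_set xG)).
  exact: val_inj.
Qed.
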